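(* There is a constant $c>0$ such that for every $n$ there exists an interval graph $G$ on $n$ vertices with $\mathrm{sd}(G)\ge c\sqrt[4]{n}$.
   Context: An interval graph is the intersection graph of a finite family of intervals on the real line. For a graph $G$ and distinct vertices $u,v$, $\mathrm{sd}_G(u,v)$ is the number of vertices other than $u,v$ that are adjacent to exactly one of $u$ and $v$. The symmetric difference of $G$ is $\mathrm{sd}(G)=\max_H \min_{u\ne v\in V(H)} \mathrm{sd}_H(u,v)$, the maximum taken over all induced subgraphs $H$ of $G$ with at least two vertices.
   Formalization: The claim is proved for every n ≥ 4 rather than every n: for n = 2 and 3 every graph has sd(G) = 0, so the bound fails, and for n < 2 sd(G) is undefined. *)

(* Defs.v *)
From mathcomp Require Import all_boot all_order all_algebra.
From mathcomp Require Import reals exp.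

Set Implicit Arguments.
Unset Strict Implicit.
Unset Printing Implicit Defensive.

Record sgraph := SGraph {
  vertex :> finType;
  edge : rel vertex;
  edge_sym : symmetric edge;
  edge_irr : irreflexive edge
}.

Section Induced.
Variables (G : sgraph) (H : {set G}).

Definition induced_edge : rel {x : G | x \in H} :=
  [rel x y | edge (val x) (val y)].

Lemma induced_edge_sym : symmetric induced_edge.
Proof. by move=> x y; apply: edge_sym. Qed.

Lemma induced_edge_irr : irreflexive induced_edge.
Proof. by move=> x; apply: edge_irr. Qed.

Definition induced : sgraph := SGraph induced_edge_sym induced_edge_irr.
End Induced.

(* The intervals of R are arbitrary nonempty ones: each end may be open, closed
   or infinite. [interval R] also contains degenerate, empty values such as
   ]1, 0[, whence the nonemptiness clause. *)
Definition interval_graph (R : realType) (G : sgraph) : Prop :=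
  exists I : G -> interval R,
    (forall u, exists x : R, x \in I u) /\
    (forall u v, u != v ->
       (edge u v <-> exists x : R, x \in I u /\ x \in I v)).

Definition sd (G : sgraph) (u v : G) : nat :=
  #|[set w : G | [&& w != u, w != v & edge w u (+) edge w v]]|.

(* The minimum of [sd u v] over pairs of distinct vertices. The initial value
   #|G| of the iterated minimum exceeds every [sd u v], so it does not matter as
   soon as G has at least two vertices. *)
Definition min_sd (G : sgraph) : nat :=
  \big[Order.min/#|G|]_(p : G * G | p.1 != p.2) sd p.1 p.2.

Definition symdiff (G : sgraph) : nat :=
  \max_(H : {set G} | 1 < #|H|) min_sd (induced H).

(* Main.v *)
(* Fix k and take all integer intervals [x, x + k t] inside [0, 3 k^2) with
   0 <= t < k. Intervals with a common end differ by at least k at the other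
   one, and one-point intervals fill the gap. Otherwise it suffices to find a
   point that lies in only one of the two intervals and is an end of them or
   next to one, at which k intervals start or k intervals end. At least k
   intervals end at every point from k^2 on, and at least k start at every point
   up to 2 k^2. As all lengths are below k^2, no two intervals are so placed
   that both supplies fail. This yields symmetric difference at least k - 2 on
   about 3 k^3 vertices, hence even a bound of order n^(1/3). *)
Require Import Defs.
From mathcomp Require Import all_boot all_order all_algebra.
From mathcomp Require Import reals exp.
From mathcomp Require Import zify.

Set Implicit Arguments.
Unset Strict Implicit.
Unset Printing Implicit Defensive.

Import Order.TTheory GRing.Theory Num.Theory.

(** * Lower bounds for the symmetric difference from one vertex set *)

Section InducedMinSd.
Local Open Scope nat_scope.
Variable G : sgraph.

(** Kept inside [G], so that counting avoids the subtype of vertices of [induced H]. *)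
Definition distinguishers (H : {set G}) (u v : G) : {set G} :=
  [set w in H | [&& w != u, w != v & edge w u (+) edge w v]].

Lemma distinguishersC (H : {set G}) (u v : G) :
  distinguishers H u v = distinguishers H v u.
Proof. by apply/setP => w; rewrite !inE addbC (andbCA (w != u)). Qed.

Lemma sd_induced (H : {set G}) (u v : induced H) :
  sd u v = #|distinguishers H (val u) (val v)|.
Proof.
rewrite /sd -(card_imset _ val_inj); apply: eq_card => w.
apply/imsetP/idP => [[x]|]; rewrite !inE.
  by move=> hx ->; rewrite (valP x).
by case/andP=> wH hw; exists (exist _ w wH); rewrite ?inE.
Qed.

Lemma symdiff_ge (H : {set G}) (s : nat) : 1 < #|H| ->
  {in H &, forall u v, u != v -> s <= #|distinguishers H u v|} ->
  s <= symdiff G.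
Proof.
move=> H1 Hs.
(* The iterated minimum starts from the order of [induced H], so [s] must stay below this default
   too; the distinguishers of any one pair lie in [H] and give it. *)
have sH : s <= #|H|.
  have [u [v [uH vH uv]]] := card_gt1P H1.
  apply: leq_trans (Hs u v uH vH uv) (subset_leq_card _).
  by apply/subsetP => w /setIdP[].
apply: leq_trans (leq_bigmax_cond _ H1).
apply: (big_ind (fun m => s <= m)); first by rewrite card_sig.
  by move=> x y hx hy; rewrite minEnat leq_min hx hy.
move=> [u v] uv; rewrite sd_induced.
exact: Hs (valP u) (valP v) uv.
Qed.

End InducedMinSd.

(** * Intersection graphs of integer intervals *)

Section NatIntervals.
Local Open Scope nat_scope.
Variables (l r : nat -> nat) (n : nat).

Definition meets (i j : nat) : bool := (l i <= r j) && (l j <= r i).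

Definition meet_edge : rel 'I_n := fun i j => (i != j) && meets i j.

Lemma meet_edge_sym : symmetric meet_edge.
Proof. by move=> i j; rewrite /meet_edge eq_sym /meets [X in _ && X]andbC. Qed.

Lemma meet_edge_irr : irreflexive meet_edge.
Proof. by move=> i; rewrite /meet_edge eqxx. Qed.

Definition meet_graph : sgraph := SGraph meet_edge_sym meet_edge_irr.

Lemma meet_graph_interval (R : realType) :
  (forall i, l i <= r i) -> interval_graph R meet_graph.
Proof.
move=> lr.
exists (fun i : 'I_n => `[(l i)%:R, (r i)%:R]%R); split=> [i|i j ij].
  by exists ((l i)%:R)%R; rewrite in_itv /= lexx ler_nat lr.
rewrite /= /meet_edge ij /= /meets; split=> [/andP[lirj ljri]|[x]].
  (* Two closed intervals that meet share the larger of their left ends. *)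
  exists (maxn (l i) (l j))%:R%R.
  by rewrite !in_itv /= !ler_nat !geq_max !leq_max !leqnn !lr lirj ljri orbT.
rewrite !in_itv /= => -[/andP[lix xri] /andP[ljx xrj]].
by rewrite -!(ler_nat R) (le_trans lix xrj) (le_trans ljx xri).
Qed.

(** Away from [u] and [v], [edge] agrees with [meets]. The values of [f] may include [u] and [v]
    themselves, which costs 2. *)
Lemma meet_distinguishers_ge (H : {set meet_graph}) (u v : 'I_n) (k : nat)
    (f : nat -> nat) :
  (forall t, t < k -> exists2 i : 'I_n, i \in H & f t = i) ->
  {in [pred t | t < k] &, injective f} ->
  (forall t, t < k -> meets (f t) u (+) meets (f t) v) ->
  k - 2 <= #|distinguishers H u v|.
Proof.
move=> fH finj fuv.
pose D := [set w : 'I_n | (w \in H) && (meets w u (+) meets w v)].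
have kD : k <= #|D|.
  pose s := [seq f t | t <- iota 0 k].
  have us : uniq s.
    rewrite map_inj_in_uniq ?iota_uniq // => x y.
    by rewrite !mem_iota; apply: finj.
  rewrite cardE -(size_map val) -[k in k <= _](size_iota 0) -(size_map f).
  apply: (uniq_leq_size us) => _ /mapP[t + ->].
  rewrite mem_iota /= => tk; have [i iH fti] := fH t tk.
  by apply/mapP; exists i => //; rewrite mem_enum inE iH -fti fuv.
rewrite leq_subLR; apply: (leq_trans kD).
have sDuv : D \subset [set u; v] :|: distinguishers H u v.
  apply/subsetP => w; rewrite !inE => /andP[-> wuv] /=.
  by rewrite /meet_edge; case: eqVneq => //= _; case: eqVneq.
apply: leq_trans (subset_leq_card sDuv) (leq_trans (leq_card_setU _ _) _).
by rewrite leq_add2r cards2; case: (_ != _).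
Qed.

End NatIntervals.

(** * The grid of intervals with lengths divisible by k *)

Section GridIntervals.
Local Open Scope nat_scope.
Variables k n : nat.
Hypotheses (k_gt2 : 2 < k) (n_large : 3 * k ^ 3 <= n).

(** The index a * k + b with b < k encodes the interval [a, a + k * b]. *)
Definition left_end (i : nat) : nat := i %/ k.
Definition right_end (i : nat) : nat := i %/ k + k * (i %% k).

Notation G := (meet_graph left_end right_end n).

(** The graph has exactly [n] vertices; passing to this induced subgraph discards the surplus
    ones. *)
Definition grid_core : {set G} := [set i : 'I_n | right_end i < 3 * k ^ 2].

Lemma grid_index (a b : nat) : b < k ->
  left_end (a * k + b) = a /\ right_end (a * k + b) = a + k * b.
Proof.
move=> bk; rewrite /left_end /right_end modnMDl modn_small //.
by rewrite divnMDl ?divn_small ?addn0 //; lia.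
Qed.

Lemma grid_index_bound (a b : nat) : b < k -> a + k * b < 3 * k ^ 2 ->
  a * k + b < n.
Proof.
move=> bk ab; apply: leq_trans n_large.
have : a.+1 * k <= 3 * k ^ 2 * k by rewrite leq_mul2r; lia.
by rewrite -mulnA -expnSr mulSn; lia.
Qed.

(** Translates indices into geometry: the k witnesses are given as intervals
    [a t, a t + k * b t]. *)
Lemma grid_distinguishers_ge (u v : 'I_n) (a b : nat -> nat) :
  (forall t, t < k -> b t < k /\ a t + k * b t < 3 * k ^ 2) ->
  (forall t t', a t = a t' -> b t = b t' -> t = t') ->
  (forall t, t < k ->
     ((a t <= right_end u) && (left_end u <= a t + k * b t)) (+)
     ((a t <= right_end v) && (left_end v <= a t + k * b t))) ->
  k - 2 <= #|distinguishers grid_core u v|.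
Proof.
move=> hab inj_ab huv.
apply: (@meet_distinguishers_ge left_end right_end n grid_core u v k
          (fun t => a t * k + b t)).
- move=> t tk; have [bk ab] := hab t tk.
  exists (Ordinal (grid_index_bound bk ab)) => //.
  by rewrite inE /=; have [_ ->] := grid_index (a t) bk.
- move=> t t' tk t'k /= e.
  have [bk _] := hab t tk; have [b'k _] := hab t' t'k.
  apply: inj_ab; first
    by rewrite -(grid_index (a t) bk).1 e (grid_index _ b'k).1.
  by rewrite -[b t](modn_small bk) -(modnMDl (a t)) e modnMDl modn_small.
- move=> t tk; have [bk _] := hab t tk.
  by rewrite /meets !(grid_index (a t) bk).1 !(grid_index (a t) bk).2 huv.
Qed.

Lemma grid_core_left_lt (u v : 'I_n) :
  u \in grid_core -> v \in grid_core -> left_end u < left_end v ->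
  k - 2 <= #|distinguishers grid_core u v|.
Proof.
rewrite !inE => uH vH luv.
have kt t : t < k -> k * t + k <= k ^ 2.
  by move=> tk; rewrite addnC -mulnS -mulnn leq_mul2l tk orbT.
have ju : u %% k < k by rewrite ltn_mod; lia.
have jv : v %% k < k by rewrite ltn_mod; lia.
have ru : right_end u = left_end u + k * (u %% k) by [].
have rv : right_end v = left_end v + k * (v %% k) by [].
have ku := kt _ ju; have kv := kt _ jv.
have inj_t t t' : k * t = k * t' -> t = t'.
  by move/eqP; rewrite eqn_mul2l => /orP[/eqP|/eqP//]; lia.
(* The supply of k intervals ending at [c]; [k ^ 2 <= c] keeps the subtraction [c - k * t] from
   truncating. *)
have ends c : c < 3 * k ^ 2 -> k ^ 2 <= c ->
  (forall t, t < k -> ((c - k * t <= right_end u) && (left_end u <= c)) (+)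
                      ((c - k * t <= right_end v) && (left_end v <= c))) ->
  k - 2 <= #|distinguishers grid_core u v|.
  move=> c3 c1 huv.
  apply: (grid_distinguishers_ge (a := fun t => c - k * t) (b := id)) => //.
    by move=> t tk; have := kt t tk; lia.
  move=> t tk; have := kt t tk; have := huv t tk => + ?.
  by have -> : c - k * t + k * t = c by lia.
have starts c : c + k ^ 2 <= 3 * k ^ 2 ->
  (forall t, t < k -> ((c <= right_end u) && (left_end u <= c + k * t)) (+)
                      ((c <= right_end v) && (left_end v <= c + k * t))) ->
  k - 2 <= #|distinguishers grid_core u v|.
  move=> c3 huv.
  apply: (grid_distinguishers_ge (a := fun=> c) (b := id)) => //.
  by move=> t tk; have := kt t tk; lia.
have [overlap|disj] := leqP (left_end v) (right_end u).
  have [ruv|ruv] := eqVneq (right_end u) (right_end v).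
    have far : left_end u + k <= left_end v.
      have jvu : (v %% k).+1 <= u %% k.
        rewrite ltnNge; apply/negP => juv.
        have : k * (u %% k) <= k * (v %% k) by rewrite leq_mul2l juv orbT.
        lia.
      have : k * (v %% k).+1 <= k * (u %% k) by rewrite leq_mul2l jvu orbT.
      by rewrite mulnS; lia.
    (* One-point intervals in [u], left of [v]. *)
    apply: (grid_distinguishers_ge (a := fun t => left_end u + t)
              (b := fun=> 0)).
    - by move=> t tk; lia.
    - by move=> t t' /addnI.
    - by move=> t tk; rewrite muln0 addn0; lia.
  have [xbig|xsmall] := leqP (k ^ 2) (left_end u).
    by apply: (ends (left_end u)) => [||t tk]; lia.
  (* Just past the smaller right end, only the interval reaching further is met. As [left_end u] is
     below k^2, this point is below 2 k^2. *)
  by apply: (starts (minn (right_end u) (right_end v)).+1) => [|t tk]; lia.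
have [ybig|ysmall] := leqP (k ^ 2) (right_end u).
  by apply: (ends (right_end u)) => [||t tk]; lia.
have [near|far] := leqP (left_end v) (2 * k ^ 2).
  by apply: (starts (left_end v)) => [|t tk]; lia.
(* The gap between [u] and [v] now exceeds k^2, so no interval starting at [right_end u] reaches
   [v]. *)
by apply: (starts (right_end u)) => [|t tk]; [|have := kt t tk]; lia.
Qed.

Lemma grid_core_left_eq (u v : 'I_n) :
  v \in grid_core -> left_end u = left_end v -> right_end u < right_end v ->
  k - 2 <= #|distinguishers grid_core u v|.
Proof.
rewrite inE => vH luv ruv.
(* Both lengths are multiples of k, so distinct right ends over a common left end are at least k
   apart. *)
have far : right_end u + k <= right_end v.
  move: ruv; rewrite /right_end -!/(left_end _) luv ltn_add2l -addnA leq_add2l.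
  by rewrite ltn_mul2l => /andP[_ ?]; rewrite addnC -mulnS leq_mul2l orbC; lia.
have lru : left_end u <= right_end u by apply: leq_addr.
apply: (grid_distinguishers_ge (a := fun t => (right_end u).+1 + t)
          (b := fun=> 0)).
- by move=> t tk; lia.
- by move=> t t' /addnI.
- by move=> t tk; rewrite muln0 addn0; lia.
Qed.

Lemma grid_symdiff : k - 2 <= symdiff G.
Proof.
apply: (@symdiff_ge _ grid_core) => [|u v uH vH uv].
  (* Indices 0 and 1 encode [0, 0] and [0, k], two vertices of the core. *)
  have core i : i < 2 -> exists2 j : 'I_n, j \in grid_core & j = i :> nat.
    move=> i2; have ik : i < k by lia.
    have ib : 0 + k * i < 3 * k ^ 2.
      by rewrite -mulnn; have : k * i <= k * k; [rewrite leq_mul2l | ]; nia.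
    have := grid_index_bound ik ib; rewrite mul0n add0n => iN.
    exists (Ordinal iN) => //.
    by rewrite inE /=; have := grid_index 0 ik; rewrite mul0n add0n => -[_ ->].
  have [x xH x0] := core 0 isT; have [y yH y1] := core 1 isT.
  apply/card_gt1P; exists x, y; split=> //.
  by apply/eqP => xy; move: x0; rewrite xy y1.
have [luv|lvu|luv] := ltngtP (left_end u) (left_end v).
- exact: grid_core_left_lt.
- by rewrite distinguishersC; apply: grid_core_left_lt.
have [ruv|rvu|ruv] := ltngtP (right_end u) (right_end v).
- exact: grid_core_left_eq.
- by rewrite distinguishersC; apply: grid_core_left_eq.
case/eqP: uv; apply: val_inj => /=.
move: ruv; rewrite /right_end -!/(left_end _) luv => /addnI/eqP.
rewrite eqn_mul2l => /orP[/eqP|/eqP muv]; first by lia.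
by rewrite (divn_eq u k) (divn_eq v k) -!/(left_end _) luv muv.
Qed.

End GridIntervals.

(** * Paths, for few vertices *)

Lemma path_symdiff (n : nat) : (3 < n)%N ->
  (0 < symdiff (meet_graph id succn n))%N.
Proof.
move=> n4; pose G := meet_graph id succn n.
apply: (@symdiff_ge G [set: 'I_n]) => [|u v _ _].
  by rewrite cardsT card_ord; lia.
suff lt_case (x y : 'I_n) : (x < y)%N ->
    (0 < #|distinguishers (G := G) [set: 'I_n] x y|)%N.
  rewrite neq_ltn => /orP[|]; first exact: lt_case.
  by rewrite distinguishersC; apply: lt_case.
move=> xy; have yn := ltn_ord y.
suff [w [wn wx wy wxy]] : exists w, [/\ (w < n)%N, w != x, w != y &
    meets id succn w x (+) meets id succn w y].
  apply/card_gt0P; exists (Ordinal wn).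
  by rewrite !inE /= /meet_edge -!val_eqE /= wx wy.
(* The intervals [i, i + 1] form a path. The outer neighbour of [x] or of [y] separates them; if
   they are the two ends of the path, vertex 1 does, since [n] is at least 4. *)
rewrite /meets; have [x0|x0] := posnP x.
  have [yn1|yn1] := ltnP y.+1 n.
    by exists y.+1; split; lia.
  by exists 1; split; lia.
by exists x.-1; split; lia.
Qed.

(** * Choice of k and the fourth-root bound *)

Local Open Scope ring_scope.

Lemma interval_graph_symdiff (R : realType) (n : nat) : (4 <= n)%N ->
  exists (G : sgraph) (s : nat),
    [/\ #|G| = n, interval_graph R G, (s <= symdiff G)%N &
        (n <= (4 * s) ^ 4)%N].
Proof.
(* From 81 vertices on, the largest k with 3 k^3 <= n is at least 3, so k - 2 is positive; below, s
   = 1 suffices as 81 <= 4^4. *)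
move=> n4; have [nsmall|nlarge] := ltnP n (3 * 3 ^ 3).
  exists (meet_graph id succn n), 1%N; split;
    [exact: card_ord | | exact: path_symdiff | lia].
  by apply: meet_graph_interval => i; apply: leqnSn.
pose P k := (3 * k ^ 3 <= n)%N.
have exP : exists k, P k by exists 3.
have ubP k : P k -> (k <= n)%N.
  by rewrite /P !expnS; case: k => // k; nia.
case: (ex_maxnP exP ubP) => k Pk maxk.
have k3 : (2 < k)%N by apply: maxk.
have nk : (n < 3 * k.+1 ^ 3)%N
  by rewrite ltnNge; apply/negP => /maxk; rewrite ltnn.
exists (meet_graph (left_end k) (right_end k) n), (k - 2)%N; split.
- exact: card_ord.
- by apply: meet_graph_interval => i; apply: leq_addr.
- exact: grid_symdiff.
apply: leq_trans (ltnW nk) _.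
(* Equality at k = 3 dictates the factor 4. *)
have h : (k.+1 <= 4 * (k - 2))%N by lia.
have h3 : (k.+1 ^ 3 <= (4 * (k - 2)) ^ 3)%N by rewrite leq_exp2r.
rewrite [in leqRHS]expnS; apply: leq_mul => //; lia.
Qed.

(** The range of [n] starts at 4 because every graph on one to three vertices has symmetric
    difference 0: with two or three vertices, some pair has no distinguishing vertex. *)
Theorem theorem7 (R : realType) :
  exists c : R, 0 < c /\
    forall n : nat, (4 <= n)%N ->
      exists G : sgraph,
        [/\ #|G| = n, interval_graph R G &
            c * n%:R `^ 4%:R^-1 <= (symdiff G)%:R].
Proof.
exists 4%:R^-1; split; first by rewrite invr_gt0 ltr0n.
move=> n n4; have [G [s [Gn Gi sG ns]]] := interval_graph_symdiff R n4.
exists G; split=> //.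
rewrite mulrC ler_pdivrMr ?ltr0n // -natrM.
apply: (@le_trans _ _ ((4 * s)%N%:R)); last first.
  by rewrite ler_nat mulnC leq_mul2r sG orbT.
(* With 4 s written as a fourth root, monotonicity reduces the bound to n <= (4 s)^4. *)
have -> : (4 * s)%N%:R = ((4 * s)%N%:R ^+ 4) `^ 4%:R^-1 :> R.
  by rewrite -powR_mulrn ?ler0n // -powRrM divff ?pnatr_eq0 // powRr1 ?ler0n.
apply: ge0_ler_powR; rewrite ?nnegrE ?invr_ge0 ?exprn_ge0 ?ler0n //.
by rewrite -natrX ler_nat.
Qed.
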